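(* Let $\mathscr{A}=(a_{ijklpq})\in\mathbb{T}_{6,3}$ be a paired symmetric tensor (in particular, possibly an elasticity tensor). If the polynomial $\mathscr{A}x^2y^2z^2$ is a sum of squares of trilinear forms, then $a_{iikkpp}\ge0$ for all $i,k,p\in\{1,2,3\}$.
   Context: $\mathbb{T}_{6,3}$ is the set of real tensors $\mathscr{A}=(a_{ijklpq})$ with $i,j,k,l,p,q\in\{1,2,3\}$. $\mathscr{A}$ is paired symmetric if $a_{ijklpq}=a_{jiklpq}=a_{ijlkpq}=a_{ijklqp}$ for all indices; a paired symmetric tensor is an elasticity tensor if moreover $a_{ijklpq}=a_{klijpq}=a_{ijpqkl}$ for all indices. For $x,y,z\in\mathbb{R}^3$, $\mathscr{A}x^2y^2z^2:=\sum_{i,j,k,l,p,q=1}^3a_{ijklpq}x_ix_jy_ky_lz_pz_q$; it is a sum of squares of trilinear forms if it equals $\sum_{s=1}^r\big(\sum_{i,k,p=1}^3\alpha^s_{ikp}x_iy_kz_p\big)^2$ identically for some $r\ge1$ and real $\alpha^s_{ikp}$. *)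

(* Defs.v *)
From mathcomp Require Import all_boot all_order all_algebra.
From mathcomp Require Import reals.

Set Implicit Arguments.
Unset Strict Implicit.
Unset Printing Implicit Defensive.

Import Order.TTheory GRing.Theory Num.Theory.
Local Open Scope ring_scope.

(* Indices 1, 2, 3 are represented by 0, 1, 2 : 'I_3. *)
Definition tensor63 (R : realType) : Type :=
  'I_3 -> 'I_3 -> 'I_3 -> 'I_3 -> 'I_3 -> 'I_3 -> R.

Definition paired_symmetric (R : realType) (A : tensor63 R) : Prop :=
  forall i j k l p q : 'I_3,
    [/\ A i j k l p q = A j i k l p q,
        A i j k l p q = A i j l k p q
      & A i j k l p q = A i j k l q p].

Definition triquadratic_form (R : realType) (A : tensor63 R)
    (x y z : 'rV[R]_3) : R :=
  \sum_(i < 3) \sum_(j < 3) \sum_(k < 3) \sum_(l < 3) \sum_(p < 3) \sum_(q < 3)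
    A i j k l p q * x 0 i * x 0 j * y 0 k * y 0 l * z 0 p * z 0 q.

Definition trilinear_form (R : realType) (alpha : 'I_3 -> 'I_3 -> 'I_3 -> R)
    (x y z : 'rV[R]_3) : R :=
  \sum_(i < 3) \sum_(k < 3) \sum_(p < 3) alpha i k p * x 0 i * y 0 k * z 0 p.

(* Over the reals, identity of polynomials is identity of the polynomial
   functions. *)
Definition is_sos_trilinear (R : realType) (A : tensor63 R) : Prop :=
  exists (r : nat) (alpha : 'I_r -> 'I_3 -> 'I_3 -> 'I_3 -> R),
    (1 <= r)%N /\
    forall x y z : 'rV[R]_3,
      triquadratic_form A x y z =
      \sum_(s < r) trilinear_form (alpha s) x y z ^+ 2.

(* Main.v *)
Require Import Defs.
From mathcomp Require Import all_boot all_order all_algebra.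
From mathcomp Require Import reals.

Import Order.TTheory GRing.Theory Num.Theory.
Local Open Scope ring_scope.

(** At the standard basis vectors $x=e_i$, $y=e_k$, $z=e_p$ the only surviving term of
    $\mathscr{A}x^2y^2z^2$ is $a_{iikkpp}$ ([triquadratic_form_delta]). The sum-of-squares identity,
    evaluated there, exhibits this entry as a sum of real squares. *)

Lemma sum_mul_delta (R : pzSemiRingType) (n : nat) (F : 'I_n -> R) (i : 'I_n) :
  \sum_(j < n) F j * (delta_mx 0 i : 'rV[R]_n) 0 j = F i.
Proof.
rewrite (bigD1 i) //= big1 => [|j ji]; first by rewrite mxE !eqxx mulr1 addr0.
by rewrite mxE (negbTE ji) andbF mulr0.
Qed.

Lemma triquadratic_form_delta (R : realType) (A : tensor63 R) (i k p : 'I_3) :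
  triquadratic_form A (delta_mx 0 i) (delta_mx 0 k) (delta_mx 0 p) =
  A i i k k p p.
Proof.
rewrite /triquadratic_form.
(* The sums collapse from the innermost outwards: products associate to the left, so at each stage
   the last factor is the basis-vector coordinate at the current summation index, as [sum_mul_delta]
   requires. *)
under eq_bigr => a _.
  under eq_bigr => b _.
    under eq_bigr => c _.
      under eq_bigr => d _.
        under eq_bigr => e _ do rewrite sum_mul_delta.
        rewrite sum_mul_delta; over.
      rewrite sum_mul_delta; over.
    rewrite sum_mul_delta; over.
  rewrite sum_mul_delta; over.
exact: sum_mul_delta.
Qed.

Theorem theorem5p18 (R : realType) (A : tensor63 R)
    (hA : paired_symmetric A) (hsos : is_sos_trilinear A) :
  forall i k p : 'I_3, 0 <= A i i k k p p.
Proof.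
move=> i k p; have [r [alpha [_ sosA]]] := hsos.
rewrite -triquadratic_form_delta sosA.
by apply: sumr_ge0 => s _; apply: sqr_ge0.
Qed.
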